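(* Let $\boldsymbol{z}^\star$ be an optimal solution to the full-scale model (F) and let $\boldsymbol{\hat z}^\star$ be an optimal solution to the aggregated model (A). Then the optimal objective value of the aggregated model is a lower bound on that of the full-scale model: $$\hat J(\boldsymbol{\hat z}^\star)\le J(\boldsymbol{z}^\star).$$
   Context: Let $\boldsymbol{G}$ (generators) and $\boldsymbol{T}$ (time periods) be finite nonempty sets. The given real parameters are: operational costs $C^{\mathrm{op}}_g$, investment costs $C^{\mathrm{inv}}_g$, and minimum and maximum installable capacities $\underline{X}_g, \overline{X}_g$ for $g\in\boldsymbol{G}$; a penalty cost $C^{\mathrm{ns}}$ for non-supplied demand; capacity factors $F_{g,t}$ and demands $D_t$ for $g\in\boldsymbol{G}$, $t\in\boldsymbol{T}$; and a sampling time $\Delta>0$. Full-scale model (F): the decision variables are $\boldsymbol{z}=\{x_g, b_g, p_{g,t}, d^{\mathrm{ns}}_t \mid g\in\boldsymbol{G}, t\in\boldsymbol{T}\}$ with $x_g, p_{g,t}, d^{\mathrm{ns}}_t$ real and $b_g\in\{0,1\}$. Minimize $$J(\boldsymbol{z}) := \sum_{g\in\boldsymbol{G}} C^{\mathrm{inv}}_g x_g + \sum_{t\in\boldsymbol{T}}\Big(\sum_{g\in\boldsymbol{G}} C^{\mathrm{op}}_g p_{g,t}\Delta + C^{\mathrm{ns}} d^{\mathrm{ns}}_t\Big)$$ subject to: $\sum_{g\in\boldsymbol{G}} p_{g,t}\Delta + d^{\mathrm{ns}}_t = D_t$ for all $t$; $0\le p_{g,t}\le F_{g,t}x_g$ for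 all $g,t$; $b_g\underline{X}_g\le x_g\le b_g\overline{X}_g$ for all $g$. Clusters: $\boldsymbol{K}$ is a finite index set, and $\{\boldsymbol{T}_k \mid k\in\boldsymbol{K}\}$ is an arbitrary partition of $\boldsymbol{T}$ into nonempty subsets (clusters of time periods); $T_k := |\boldsymbol{T}_k|$. Aggregated model (A): the decision variables are $\boldsymbol{\hat z}=\{\hat x_g,\hat b_g,\hat p_{g,k},\hat d^{\mathrm{ns}}_k \mid g\in\boldsymbol{G}, k\in\boldsymbol{K}\}$ with $\hat x_g,\hat p_{g,k},\hat d^{\mathrm{ns}}_k$ real and $\hat b_g\in\{0,1\}$. Minimize $$\hat J(\boldsymbol{\hat z}) := \sum_{g\in\boldsymbol{G}} C^{\mathrm{inv}}_g \hat x_g + \sum_{k\in\boldsymbol{K}} T_k\Big(\sum_{g\in\boldsymbol{G}} C^{\mathrm{op}}_g \hat p_{g,k}\Delta + C^{\mathrm{ns}}\hat d^{\mathrm{ns}}_k\Big)$$ subject to: $\sum_{g\in\boldsymbol{G}}\hat p_{g,k}\Delta + \hat d^{\mathrm{ns}}_k = \frac{1}{T_k}\sum_{t\in\boldsymbol{T}_k} D_t$ for all $k$; $0\le \hat p_{g,k}\le \frac{\hat x_g}{T_k}\sum_{t\in\boldsymbol{T}_k}F_{g,t}$ for all $g,k$; $\hat b_g\underline{X}_g\le\hat x_g\le\hat b_g\overline{X}_g$ for all $g$. *)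

(* Defs.v *)
From HB Require Import structures.
From mathcomp Require Import all_boot all_order all_algebra.
From mathcomp Require Import reals.
Set Implicit Arguments.
Unset Strict Implicit.
Unset Printing Implicit Defensive.
Import Order.TTheory GRing.Theory Num.Theory.
Local Open Scope ring_scope.

(* No sign or ordering condition is imposed on the data; in particular the
   positivity of the sampling time [Delta] is left to the theorem. *)
Record params (R : realType) (G T : finType) := Params {
  C_op : G -> R;
  C_inv : G -> R;
  X_min : G -> R;
  X_max : G -> R;
  C_ns : R;
  cap_factor : G -> T -> R;
  demand : T -> R;
  Delta : R }.

(* Binary variables are booleans, embedded in R by (b g)%:R. *)
Record full_var (R : realType) (G T : finType) := FullVar {
  z_x : G -> R;
  z_b : G -> bool;
  z_p : G -> T -> R;
  z_dns : T -> R }.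

Record agg_var (R : realType) (G K : finType) := AggVar {
  zh_x : G -> R;
  zh_b : G -> bool;
  zh_p : G -> K -> R;
  zh_dns : K -> R }.

Definition full_cost (R : realType) (G T : finType) (P : params R G T)
    (z : full_var R G T) : R :=
  \sum_g C_inv P g * z_x z g
  + \sum_t ((\sum_g C_op P g * z_p z g t * Delta P) + C_ns P * z_dns z t).

Definition full_feasible (R : realType) (G T : finType) (P : params R G T)
    (z : full_var R G T) : Prop :=
  [/\ forall t, (\sum_g z_p z g t * Delta P) + z_dns z t = demand P t,
      forall g t, 0 <= z_p z g t <= cap_factor P g t * z_x z g
    & forall g, (z_b z g)%:R * X_min P g <= z_x z g <= (z_b z g)%:R * X_max P g].

(* [cl k] is the cluster of index k. Injectivity of [cl] makes distinct indices
   denote distinct, hence disjoint, clusters; [partition] includes the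
   nonemptiness of every cluster. *)
Definition clustering (T K : finType) (cl : K -> {set T}) : Prop :=
  injective cl /\ partition [set cl k | k : K] [set: T].

Definition agg_cost (R : realType) (G T K : finType) (P : params R G T)
    (cl : K -> {set T}) (z : agg_var R G K) : R :=
  \sum_g C_inv P g * zh_x z g
  + \sum_k #|cl k|%:R
      * ((\sum_g C_op P g * zh_p z g k * Delta P) + C_ns P * zh_dns z k).

Definition agg_feasible (R : realType) (G T K : finType) (P : params R G T)
    (cl : K -> {set T}) (z : agg_var R G K) : Prop :=
  [/\ forall k, (\sum_g zh_p z g k * Delta P) + zh_dns z k
                = 1 / #|cl k|%:R * \sum_(t in cl k) demand P t,
      forall g k, 0 <= zh_p z g k
                    <= zh_x z g / #|cl k|%:R * \sum_(t in cl k) cap_factor P g t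
    & forall g, (zh_b z g)%:R * X_min P g <= zh_x z g <= (zh_b z g)%:R * X_max P g].

Definition optimal (R : realType) (Z : Type) (feasible : Z -> Prop)
    (cost : Z -> R) (z : Z) : Prop :=
  feasible z /\ forall z', feasible z' -> cost z <= cost z'.

(* Main.v *)
Require Import Defs.
From mathcomp Require Import all_boot all_order all_algebra.
From mathcomp Require Import reals.
Local Open Scope ring_scope.

(** Averaging a full-scale solution over each cluster, while keeping its
    investment decisions, gives a point of the aggregated model. Every
    operational constraint of the full-scale model is linear in the period data
    [(p, dns, F, D)] once [x] is fixed, so its average over a cluster is the
    corresponding aggregated constraint ([average_solution_feasible]). The
    weight [#|cl k|] in the aggregated objective cancels the denominator of the
    average, and the clusters partition the periods, so the averaged point has
    the same cost as the original one ([average_solution_cost]). Hence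
    minimality of the aggregated optimum bounds it by the full-scale one. *)

Import GRing.Theory Num.Theory.

Section ClusterAverage.

Variables (R : realType) (G T K : finType) (cl : K -> {set T}).

Definition cluster_mean (k : K) (f : T -> R) : R :=
  (\sum_(t in cl k) f t) / #|cl k|%:R.

Lemma cluster_meanD k f g :
  cluster_mean k (fun t => f t + g t) = cluster_mean k f + cluster_mean k g.
Proof. by rewrite /cluster_mean big_split mulrDl. Qed.

Lemma cluster_mean_sum k (f : G -> T -> R) :
  cluster_mean k (fun t => \sum_g f g t) = \sum_g cluster_mean k (f g).
Proof. by rewrite /cluster_mean exchange_big mulr_suml. Qed.

Lemma cluster_meanZl k a f :
  cluster_mean k (fun t => a * f t) = a * cluster_mean k f.
Proof. by rewrite /cluster_mean -mulr_sumr mulrA. Qed.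

Lemma cluster_meanZr k a f :
  cluster_mean k (fun t => f t * a) = cluster_mean k f * a.
Proof. by rewrite /cluster_mean -mulr_suml mulrAC. Qed.

Lemma eq_cluster_mean k f g : f =1 g -> cluster_mean k f = cluster_mean k g.
Proof. by move=> fg; rewrite /cluster_mean (eq_bigr g) // => t _; apply: fg. Qed.

Lemma ler_cluster_mean k f g :
  (forall t, f t <= g t) -> cluster_mean k f <= cluster_mean k g.
Proof.
by move=> fg; rewrite ler_wpM2r ?invr_ge0 ?ler0n // ler_sum // => t _.
Qed.

Lemma cluster_mean_ge0 k f : (forall t, 0 <= f t) -> 0 <= cluster_mean k f.
Proof. by move=> f0; rewrite divr_ge0 ?ler0n // sumr_ge0. Qed.

(** Over an empty cluster both sides are [0], since the empty sum vanishes. *)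
Lemma card_cluster_mean k f :
  #|cl k|%:R * cluster_mean k f = \sum_(t in cl k) f t.
Proof.
have [/cards0_eq cl0|cl_neq0] := eqVneq #|cl k| 0%N.
  by rewrite cl0 cards0 mul0r big_set0.
by rewrite mulrC divfK // pnatr_eq0.
Qed.

Lemma sum_clusters (f : T -> R) :
  clustering cl -> \sum_k \sum_(t in cl k) f t = \sum_t f t.
Proof.
case=> cl_inj /and3P[/eqP cover_cl triv_cl _].
have -> : \sum_t f t = \sum_(t in cover [set cl k | k : K]) f t.
  by rewrite cover_cl; apply: eq_bigl => t; rewrite inE.
by rewrite big_trivIset // big_imset //= => k l _ _; apply: cl_inj.
Qed.

Definition average_solution (z : full_var R G T) : agg_var R G K :=
  AggVar (z_x z) (z_b z) (fun g k => cluster_mean k (z_p z g))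
    (fun k => cluster_mean k (z_dns z)).

Lemma average_solution_feasible (P : params R G T) z :
  full_feasible P z -> agg_feasible P cl (average_solution z).
Proof.
case=> balance capacity investment; split=> //= [k|g k].
  rewrite div1r mulrC -/(cluster_mean k (demand P)).
  rewrite -(eq_cluster_mean k _ _ balance) cluster_meanD cluster_mean_sum.
  by under [in RHS]eq_bigr do rewrite cluster_meanZr.
rewrite cluster_mean_ge0 => [|t]; last by case/andP: (capacity g t).
rewrite mulrAC -mulrA -/(cluster_mean k (cap_factor P g)) mulrC -cluster_meanZr.
by apply: ler_cluster_mean => t; case/andP: (capacity g t).
Qed.

Lemma average_solution_cost (P : params R G T) z :
  clustering cl -> agg_cost P cl (average_solution z) = full_cost P z.
Proof.
move=> cl_part; rewrite /agg_cost /full_cost -(sum_clusters _ cl_part) /=.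
congr (_ + _); apply: eq_bigr => k _; rewrite -card_cluster_mean.
rewrite cluster_meanD cluster_mean_sum cluster_meanZl; congr (_ * (_ + _)).
by apply: eq_bigr => g _; rewrite cluster_meanZr cluster_meanZl.
Qed.

End ClusterAverage.

Theorem mainTheorem2 (R : realType) (G T K : finType)
    (G_gt0 : (0 < #|G|)%N) (T_gt0 : (0 < #|T|)%N)
    (P : params R G T) (Delta_gt0 : 0 < Delta P)
    (cl : K -> {set T}) (cl_part : clustering cl)
    (z : full_var R G T) (hz : agg_var R G K)
    (z_opt : optimal (full_feasible P) (full_cost P) z)
    (hz_opt : optimal (agg_feasible P cl) (agg_cost P cl) hz) :
  agg_cost P cl hz <= full_cost P z.
Proof.
case: z_opt hz_opt => z_feasible _ [_ hz_min].
rewrite -(average_solution_cost _ _ _ _ cl P z cl_part).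
exact/hz_min/average_solution_feasible.
Qed.
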